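(* Let $R=\bigoplus_{n\in\mathbb{Z}}R_n$ be a $\mathbb{Z}$-graded ring with Jacobson radical $J(R)$. Let $\mathcal{A}$ be the set of all maximal right ideals $M$ of $R$ such that $R_n\not\subseteq M$ for some nonzero integer $n$, and let $A(R)=\bigcap_{M\in\mathcal{A}}M$ (with $A(R)=R$ if $\mathcal{A}=\emptyset$). Put $$A_l=\{r\in R\mid R_nr\subseteq J(R)\text{ for every } 0\neq n\in\mathbb{Z}\},\qquad A_r=\{r\in R\mid rR_n\subseteq J(R)\text{ for every } 0\neq n\in\mathbb{Z}\}.$$ Then: (i) $A(R)=A_l=A_r$; (ii) $A(R)\cap\bigl(\bigoplus_{0\neq n\in\mathbb{Z}}R_n\bigr)=J(R)\cap\bigl(\bigoplus_{0\neq n\in\mathbb{Z}}R_n\bigr)$.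
   Context: All rings are associative with identity, not necessarily commutative. A $\mathbb{Z}$-graded ring is a ring $R$ with a decomposition $R=\bigoplus_{n\in\mathbb{Z}}R_n$ into additive subgroups such that $R_nR_m\subseteq R_{n+m}$ for all $n,m\in\mathbb{Z}$. *)

(* Defs.v *)
From HB Require Import structures.
From mathcomp Require Import all_boot all_order all_algebra.
From mathcomp Require Import finmap.
From mathcomp Require Import boolp classical_sets.

Set Implicit Arguments.
Unset Strict Implicit.
Unset Printing Implicit Defensive.

Import GRing.Theory.

Local Open Scope classical_set_scope.
Local Open Scope ring_scope.

(* The zero ring is allowed: [pzRingType] does not require [1 != 0]. *)

Definition right_ideal (R : pzRingType) (I : set R) : Prop :=
  zmod_closed [in I] /\ forall x r : R, I x -> I (x * r).

Definition maximal_right_ideal (R : pzRingType) (M : set R) : Prop :=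
  [/\ right_ideal M, M <> [set: R] &
      forall N : set R, right_ideal N -> M `<=` N -> N = M \/ N = [set: R]].

Definition jacobson_radical (R : pzRingType) : set R :=
  \bigcap_(M in @maximal_right_ideal R) M.

(* The additive subgroup generated by the [G n], [n \in P], when each [G n] is
   an additive subgroup. *)
Definition subgroup_sum (R : pzRingType) (G : int -> set R) (P : set int) :
    set R :=
  [set r | exists (S : {fset int}) (x : int -> R),
     (forall n, n \in S -> P n /\ G n (x n)) /\ r = \sum_(n <- S) x n].

Record Zgrading (R : pzRingType) (G : int -> set R) : Prop := {
  Zgrading_zmod : forall n : int, zmod_closed [in G n];
  Zgrading_sum : subgroup_sum G [set: int] = [set: R];
  Zgrading_direct : forall (S : {fset int}) (x : int -> R),
    (forall n, n \in S -> G n (x n)) -> \sum_(n <- S) x n = 0 ->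
    forall n, n \in S -> x n = 0;
  Zgrading_mul : forall (n m : int) (a b : R),
    G n a -> G m b -> G (n + m) (a * b) }.

Definition graded_maximal_family (R : pzRingType) (G : int -> set R) :
    set (set R) :=
  [set M | maximal_right_ideal M /\ exists n : int, n != 0 /\ ~ (G n `<=` M)].

(* [\bigcap] over the empty family is [setT], i.e. the whole ring. *)
Definition graded_A (R : pzRingType) (G : int -> set R) : set R :=
  \bigcap_(M in graded_maximal_family G) M.

Definition A_left (R : pzRingType) (G : int -> set R) : set R :=
  [set r | forall n : int, n != 0 ->
     forall a : R, G n a -> @jacobson_radical R (a * r)].

Definition A_right (R : pzRingType) (G : int -> set R) : set R :=
  [set r | forall n : int, n != 0 ->
     forall a : R, G n a -> @jacobson_radical R (r * a)].

(* Main.v *)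
Require Import Defs.
From mathcomp Require Import all_boot all_order all_algebra.
From mathcomp Require Import finmap.
From mathcomp Require Import boolp classical_sets.

(** A maximal right ideal [M] outside [graded_maximal_family G] contains every
    [G n], [n != 0], and therefore also every product [x * a] with
    [a \in G n]: the homogeneous parts of [x] send [a] to a nonzero degree,
    except the part of degree [- n], which itself already lies in the right
    ideal [M] ([mul_homog_right_ideal]).  Hence such an [M] contains the whole
    two-sided ideal generated by the [G n], [n != 0]; in module terms, the
    family is singled out by the annihilator of the simple module [R / M].

    The elementary form of that remark is that the family is stable under
    [M |-> (M : b)] for [b] outside [M] ([graded_maximal_colon]), since
    [R / (M : b)] and [R / M] are isomorphic.  Stability makes [graded_A G] a
    left ideal, and it rules out an element [r] of [A_right G] outside some
    [M] in the family, because [(M : r)] contains every [G n], [n != 0].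

    For [A_left G], let [M] be in the family and take [a] in [G n] outside
    [M], with [n != 0].  Then
    [1 = a * x + m] with [m] in [M], and [a * x] is a sum of terms that
    multiply [r] into the Jacobson radical ([mul_homog_left_ideal]), so
    [r = a * x * r + m * r] lies in [M].

    Part (ii) holds because the maximal right ideals outside the family
    contain the sum of the [G n], [n != 0], anyway. *)

Import GRing.Theory.

Local Open Scope classical_set_scope.
Local Open Scope ring_scope.

(** * Additive subgroups and right ideals *)

Lemma zmod_closedP (R : pzRingType) (K : set R) :
  zmod_closed [in K] <-> K 0 /\ forall x y, K x -> K y -> K (x - y).
Proof.
split=> -[K0 KB]; split.
- by move: K0; rewrite inE.
- by move=> x y Kx Ky; apply/set_mem; apply: KB; apply: mem_set.
- exact: mem_set.
- by move=> x y /set_mem Kx /set_mem Ky; apply: mem_set; apply: KB.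
Qed.

Section ZmodClosed.
Variables (R : pzRingType) (K : set R).
Hypothesis zmodK : zmod_closed [in K].

Lemma zmod_closed_0 : K 0.
Proof. by have /zmod_closedP[] := zmodK. Qed.

Lemma zmod_closed_sub x y : K x -> K y -> K (x - y).
Proof. by have /zmod_closedP[_] := zmodK; apply. Qed.

Lemma zmod_closed_add x y : K x -> K y -> K (x + y).
Proof.
move=> Kx Ky; rewrite -[y]opprK; apply: zmod_closed_sub => //.
by rewrite -[- y]add0r; apply: zmod_closed_sub => //; apply: zmod_closed_0.
Qed.

Lemma zmod_closed_sum (S : {fset int}) (x : int -> R) :
  (forall n, n \in S -> K (x n)) -> K (\sum_(n <- S) x n).
Proof.
move=> Kx; rewrite big_seq; apply: big_ind => //.
- exact: zmod_closed_0.
- exact: zmod_closed_add.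
Qed.

End ZmodClosed.

Section Colon.
Variable R : pzRingType.

Definition colon (M : set R) (b : R) : set R := [set x | M (b * x)].

Lemma right_ideal_colon (M : set R) b : right_ideal M -> right_ideal (colon M b).
Proof.
move=> [zM Mr]; split; last by move=> x r; rewrite /colon /= mulrA; apply: Mr.
apply/zmod_closedP; split; first by rewrite /colon /= mulr0; apply: zmod_closed_0.
by move=> x y Mx My; rewrite /colon /= mulrBr; apply: zmod_closed_sub.
Qed.

Lemma maximal_right_ideal_gen (M : set R) (c z : R) :
  maximal_right_ideal M -> ~ M c -> exists x m, M m /\ z = c * x + m.
Proof.
move=> [[zM Mr] _ Mmax] Mc.
pose N : set R := [set y | exists x m, M m /\ y = c * x + m].
have rN : right_ideal N.
  split; last first.
    move=> y r [x [m [Mm ->]]]; exists (x * r), (m * r).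
    by rewrite mulrDl mulrA; split=> //; apply: Mr.
  apply/zmod_closedP; split.
    by exists 0, 0; rewrite mulr0 addr0; split=> //; apply: zmod_closed_0.
  move=> _ _ [x [m [Mm ->]]] [x' [m' [Mm' ->]]].
  exists (x - x'), (m - m'); split; first exact: zmod_closed_sub.
  by rewrite mulrBr opprD addrACA.
have MN : M `<=` N by move=> m Mm; exists 0, m; rewrite mulr0 add0r.
have [NM|NT] := Mmax N rN MN; last by have : N z by rewrite NT.
case: Mc; rewrite -NM; exists 1, 0; rewrite mulr1 addr0; split=> //.
exact: zmod_closed_0.
Qed.

(** [x |-> b * x] induces an isomorphism of [R / (M : b)] onto the simple
    module [R / M]. *)
Lemma maximal_right_ideal_colon (M : set R) b :
  maximal_right_ideal M -> ~ M b -> maximal_right_ideal (colon M b).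
Proof.
move=> maxM Mb; have [rM MT Mmax] := maxM; have rK := right_ideal_colon M b rM.
split=> //.
  move=> KT; apply: Mb; have : colon M b 1 by rewrite KT.
  by rewrite /colon /= mulr1.
move=> N [zN Nr] KN.
have [NK|/existsNP[x /not_implyP[Nx Kx]]] := pselect (N `<=` colon M b).
  by left; apply/seteqP.
right; apply/seteqP; split=> // z _.
have [y [m [Mm bE]]] := maximal_right_ideal_gen M (b * x) b maxM Kx.
have N1 : N 1.
  rewrite -(subrK (x * y) 1); apply: zmod_closed_add => //; last exact: Nr.
  apply: KN; rewrite /colon /= mulrBr mulr1 mulrA.
  by rewrite [X in X - _]bE addrC addKr.
by rewrite -(mul1r z); apply: Nr.
Qed.

Lemma jacobson_zmod : zmod_closed [in @jacobson_radical R].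
Proof.
apply/zmod_closedP; split=> [M [[zM _] _ _]|x y Jx Jy M maxM].
  exact: zmod_closed_0.
have [[zM _] _ _] := maxM.
by apply: zmod_closed_sub => //; [apply: Jx|apply: Jy].
Qed.

Lemma jacobson_mull b r : @jacobson_radical R r -> @jacobson_radical R (b * r).
Proof.
move=> Jr M maxM; have [[_ Mr] _ _] := maxM.
have [/Mr//|Mb] := pselect (M b).
exact: (Jr _ (maximal_right_ideal_colon M b maxM Mb)).
Qed.

End Colon.

(** * Maximal right ideals of a graded ring *)

Section Graded.
Variables (R : pzRingType) (G : int -> set R).
Hypothesis hG : Zgrading G.

Lemma grading_sum (r : R) : exists (S : {fset int}) (x : int -> R),
  (forall n, n \in S -> G n (x n)) /\ r = \sum_(n <- S) x n.
Proof.
have : subgroup_sum G [set: int] r by rewrite (Zgrading_sum hG).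
by move=> [S [x [Gx ->]]]; exists S, x; split=> // n /Gx[].
Qed.

(** A term [x k * a] has nonzero degree unless [k = - n], in which case the
    factor [x k] is already in the right ideal. *)
Lemma mul_homog_right_ideal (K : set R) : right_ideal K ->
  (forall n, n != 0 -> G n `<=` K) ->
  forall n x a, n != 0 -> G n a -> K (x * a).
Proof.
move=> [zK Kr] GK n x a n0 Ga; have [S [y [Gy ->]]] := grading_sum x.
rewrite mulr_suml; apply: zmod_closed_sum => // k /Gy Gk.
have [kn0|kn0] := eqVneq (k + n) 0; last first.
  by apply: (GK _ kn0); apply: (Zgrading_mul hG).
have k0 : k != 0.
  by apply: contra_neq n0 => k0; rewrite -kn0 k0 add0r.
exact/Kr/(GK k).
Qed.

(** The mirror image, needed for the left ideal of all [y] such that [y * r]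
    lies in the Jacobson radical. *)
Lemma mul_homog_left_ideal (K : set R) :
  zmod_closed [in K] -> (forall b x, K x -> K (b * x)) ->
  (forall n, n != 0 -> G n `<=` K) ->
  forall n a x, n != 0 -> G n a -> K (a * x).
Proof.
move=> zK Kl GK n a x n0 Ga; have [S [y [Gy ->]]] := grading_sum x.
rewrite mulr_sumr; apply: zmod_closed_sum => // k /Gy Gk.
have [nk0|nk0] := eqVneq (n + k) 0; last first.
  by apply: (GK _ nk0); apply: (Zgrading_mul hG).
have k0 : k != 0.
  by apply: contra_neq n0 => k0; rewrite -nk0 k0 addr0.
exact/Kl/(GK k).
Qed.

Lemma graded_maximalP (M : set R) : maximal_right_ideal M ->
  graded_maximal_family G M \/ forall n, n != 0 -> G n `<=` M.
Proof.
move=> maxM; have [fM|fM] := pselect (graded_maximal_family G M); first by left.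
right=> n n0; apply: contrapT => GM; apply: fM.
by split=> //; exists n.
Qed.

(** If [(M : b)] contained every [G n], [n != 0], then writing
    [1 = b * x + m] would give [a = b * (x * a) + m * a], an element of [M],
    for every [a] in such a [G n]: here [x * a] lies in [(M : b)] by
    [mul_homog_right_ideal]. *)
Lemma graded_maximal_colon (M : set R) b :
  graded_maximal_family G M -> ~ M b -> graded_maximal_family G (colon R M b).
Proof.
move=> [maxM [n [n0 GM]]] Mb.
have maxK := maximal_right_ideal_colon R M b maxM Mb.
have [//|GK] := graded_maximalP _ maxK.
have [[zM Mr] _ _] := maxM; have [rK _ _] := maxK.
case: GM => a Ga; have [x [m [Mm E1]]] := maximal_right_ideal_gen R M b 1 maxM Mb.
rewrite -[a]mul1r E1 mulrDl -mulrA; apply: zmod_closed_add => //; last exact: Mr.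
exact: (mul_homog_right_ideal _ rK GK n x a n0 Ga).
Qed.

Lemma graded_A_mull b r : graded_A G r -> graded_A G (b * r).
Proof.
move=> Ar M fM; have [[[_ Mr] _ _] _] := fM.
have [/Mr//|Mb] := pselect (M b).
exact: (Ar _ (graded_maximal_colon M b fM Mb)).
Qed.

Lemma graded_A_right : graded_A G = A_right G.
Proof.
apply/seteqP; split=> r Ar.
  move=> n n0 a Ga M maxM; have [rM _ _] := maxM.
  have [/Ar|GM] := graded_maximalP M maxM; first by case: rM => _; apply.
  exact: (mul_homog_right_ideal _ rM GM n r a n0 Ga).
move=> M fM; apply: contrapT => Mr.
have [_ [n [n0]]] := graded_maximal_colon M r fM Mr; apply=> a Ga.
by apply: (Ar n n0 a Ga); case: fM.
Qed.

Lemma graded_A_left : graded_A G = A_left G.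
Proof.
apply/seteqP; split=> r Ar.
  move=> n n0 a Ga M maxM; have [[_ Mr] _ _] := maxM.
  have [fM|GM] := graded_maximalP M maxM; first exact: (graded_A_mull a r Ar M fM).
  exact/Mr/(GM n).
move=> M [maxM [n [n0 /existsNP[a /not_implyP[Ga Ma]]]]].
have [[zM Mr] _ _] := maxM.
have [x [m [Mm E1]]] := maximal_right_ideal_gen R M a 1 maxM Ma.
rewrite -[r]mul1r E1 mulrDl; apply: zmod_closed_add => //; last exact: Mr.
pose K : set R := [set y | @jacobson_radical R (y * r)].
have zJ := jacobson_zmod R.
have zK : zmod_closed [in K].
  apply/zmod_closedP; split; first by rewrite /K /= mul0r; apply: (zmod_closed_0 R _ zJ).
  by move=> y z Ky Kz; rewrite /K /= mulrBl; apply: (zmod_closed_sub R _ zJ).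
have Kl b y : K y -> K (b * y) by rewrite /K /= -mulrA; apply: jacobson_mull.
exact: (mul_homog_left_ideal K zK Kl Ar n a x n0 Ga M maxM).
Qed.

Lemma graded_A_jacobson :
  graded_A G `&` subgroup_sum G [set n : int | n != 0] =
    @jacobson_radical R `&` subgroup_sum G [set n : int | n != 0].
Proof.
apply/seteqP; split=> r [Ar sr]; split=> // M; last by case=> /Ar.
move=> maxM; have [/Ar//|GM] := graded_maximalP M maxM.
have [[zM _] _ _] := maxM; have [S [x [Gx ->]]] := sr.
by apply: zmod_closed_sum => // n /Gx[n0 /(GM n n0)].
Qed.

End Graded.

Theorem proposition3 (R : pzRingType) (G : int -> set R) (hG : Zgrading G) :
  (graded_A G = A_left G /\ A_left G = A_right G) /\
  graded_A G `&` subgroup_sum G [set n : int | n != 0] =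
    @jacobson_radical R `&` subgroup_sum G [set n : int | n != 0].
Proof.
split; last exact: graded_A_jacobson.
by rewrite -graded_A_left // -graded_A_right.
Qed.
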